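(* There exists an absolute constant $C$ such that for all positive integers $n,t$, every $t$-degenerate bipartite graph $H$ on $n$ vertices satisfies $ER(H)\le n^{Ct}$.
   Context: A graph is $t$-degenerate if its vertices can be ordered so that each vertex has at most $t$ neighbors preceding it. Edge-colorings of $K_N$ may use arbitrarily many colors. A copy of $H$ in $K_N$ (injective $\varphi:V(H)\to V(K_N)$) is canonically colored if it is monochromatic (all edges same color), rainbow (all edges distinct colors), or lexicographic: there is an ordering $v_1,\dots,v_n$ of $V(H)$ such that for each $i$ all edges $\varphi(v_i)\varphi(v_j)$ with $v_iv_j\in E(H)$, $j>i$, have the same color $c_i$, and these colors are distinct for different $v_i$. $ER(H)$ is the least $N$ such that every edge-coloring of $K_N$ contains a canonically colored copy of $H$. *)

(* Defs.v *)
From mathcomp Require Import all_boot.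
Set Implicit Arguments.
Unset Strict Implicit.
Unset Printing Implicit Defensive.

Record sgraph := SGraph {
  vertex :> finType;
  adj : rel vertex;
  adj_sym : symmetric adj;
  adj_irrefl : irreflexive adj }.

Definition edges (H : sgraph) : {set {set H}} :=
  [set e | [exists u, [exists v, adj u v && (e == [set u; v])]]].

Definition bipartite (H : sgraph) : Prop :=
  exists A : {set H}, forall u v : H, adj u v -> (u \in A) != (v \in A).

(** An ordering of the vertices is given by the position of each vertex. *)
Definition degenerate (t : nat) (H : sgraph) : Prop :=
  exists2 pos : H -> 'I_#|H|, bijective pos &
    forall v : H, #|[set u : H | adj u v && (pos u < pos v)]| <= t.

(** An edge-coloring of K_N on the vertex set 'I_N. Only the values at
    two-element sets are ever used, and the image of a finite graph has
    finitely many edges, so colors in [nat] allow arbitrarily many colors. *)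
Definition edge_coloring (N : nat) : Type := {set 'I_N} -> nat.

Section Canonical.
Variables (H : sgraph) (N : nat) (chi : edge_coloring N) (phi : H -> 'I_N).

Definition monochromatic : Prop :=
  exists c : nat, forall e, e \in edges H -> chi (phi @: e) = c.

Definition rainbow : Prop :=
  {in edges H &, injective (fun e : {set H} => chi (phi @: e))}.

(** [c u] is unconstrained by [chi] when [u] has no later neighbor; since the
    colors are in [nat], such values can always be chosen fresh, so injectivity
    of [c] only restricts the colors that actually occur. *)
Definition lexicographic : Prop :=
  exists2 pos : H -> 'I_#|H|, bijective pos &
  exists2 c : H -> nat, injective c &
    forall u v : H, adj u v -> pos u < pos v -> chi [set phi u; phi v] = c u.

Definition canonically_colored : Prop :=
  [\/ monochromatic, rainbow | lexicographic].

End Canonical.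

Definition canonical_ramsey (H : sgraph) (N : nat) : Prop :=
  forall chi : edge_coloring N,
    exists2 phi : H -> 'I_N, injective phi & canonically_colored chi phi.

(** [is_ER H N] means ER(H) = N; it includes the existence of the minimum. *)
Definition is_ER (H : sgraph) (N : nat) : Prop :=
  canonical_ramsey H N /\ forall M : nat, canonical_ramsey H M -> N <= M.

(* Main.v *)
(** Put N = n^(256 t). If at least half of the vertices of K_N see every color
    at most N / n^6 times, a uniformly random map of H into these vertices is
    injective and rainbow with positive probability, since any two fixed edges
    get the same color with probability less than n^(-4).  Otherwise many
    vertices v have a color c(v) on at least N / n^6 edges at v, and by
    pigeonhole about sqrt N of them, forming a set A, have their colors c(v)
    all equal or all distinct.  Joining every v in A to its c(v)-neighbors
    gives a bipartite graph of density n^(-6).  Two rounds of dependent random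
    choice, the first one controlling 5t-sets and the second one picking a
    common neighborhood of 4t vertices, yield U and W such that every t-set in
    either of them has n common neighbors in the other, so H embeds greedily.
    The copy is monochromatic when c is constant on A, and lexicographic, with
    the side inside A first, when c is injective on A. *)
Require Import Defs.
From mathcomp Require Import all_boot.
From Stdlib Require Import Classical.
From mathcomp Require Import zify.
Set Implicit Arguments.
Unset Strict Implicit.
Unset Printing Implicit Defensive.

Lemma leq_expn2r k m n : m <= n -> m ^ k <= n ^ k.
Proof. by case: k => // k lemn; rewrite leq_exp2r. Qed.

(** * Dependent random choice, with probabilities replaced by counts of tuples *)

Section DependentRandomChoice.
Variable V : finType.
Implicit Types (E : rel V) (A B U W S : {set V}).

Definition common_nbrs E B S := [set y in B | [forall x in S, E x y]].

Lemma common_nbrsP E B S y :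
  reflect (y \in B /\ {in S, forall x, E x y}) (y \in common_nbrs E B S).
Proof.
rewrite inE; apply: (iffP andP) => -[yB Sy]; split=> //.
  by move=> x xS; exact: (forall_inP Sy).
exact/forall_inP.
Qed.

Lemma common_nbrs_sub E B S : common_nbrs E B S \subset B.
Proof. by apply/subsetP=> y /common_nbrsP[]. Qed.

Lemma common_nbrs_anti E B S S' :
  S \subset S' -> common_nbrs E B S' \subset common_nbrs E B S.
Proof.
move=> /subsetP sSS'; apply/subsetP=> y /common_nbrsP[yB S'y].
by apply/common_nbrsP; split=> // x /sSS'; exact: S'y.
Qed.

Definition converse E : rel V := fun y x => E x y.

Lemma subset_common_nbrs E A B S (T : {set V}) : S \subset A -> T \subset B ->
  (S \subset common_nbrs (converse E) A T) = (T \subset common_nbrs E B S).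
Proof.
move=> /subsetP sSA /subsetP sTB; apply/subsetP/subsetP => sub z zin.
  by apply/common_nbrsP; split=> [|x /sub /common_nbrsP[_]]; [exact: sTB | exact].
by apply/common_nbrsP; split=> [|x /sub /common_nbrsP[_]]; [exact: sSA | exact].
Qed.

(** Samples are functions on ['I_k], repetitions allowed, so that their number is an exact power. *)
Definition img k (f : {ffun 'I_k -> V}) : {set V} := f @: 'I_k.

Lemma img_sub k (f : {ffun 'I_k -> V}) S :
  (img f \subset S) = (f \in ffun_on (mem S)).
Proof.
apply/subsetP/ffun_onP => [sub i | fS _ /imsetP[i _ ->]]; last exact: fS.
by apply: sub; exact: imset_f.
Qed.

Lemma card_img k (f : {ffun 'I_k -> V}) : #|img f| <= k.
Proof. by rewrite (leq_trans (leq_imset_card _ _)) // card_ord. Qed.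

(** Listing [S] and padding with [u] gives the tuple; this carries bounds on tuples over to sets of
    size at most [k]. *)
Lemma sub_img k S U u : u \in U -> S \subset U -> #|S| <= k ->
  exists2 f : {ffun 'I_k -> V}, img f \subset U & S \subset img f.
Proof.
move=> uU /subsetP sSU leSk.
exists [ffun i : 'I_k => nth u (enum S) i].
  rewrite img_sub; apply/ffun_onP=> i; rewrite ffunE.
  have [lt_i|ge_i] := ltnP i (size (enum S)); last by rewrite nth_default.
  by apply: sSU; rewrite -mem_enum mem_nth.
apply/subsetP=> x xS; have := xS; rewrite -mem_enum -index_mem -cardE => lt_x.
apply/imsetP; exists (Ordinal (leq_trans lt_x leSk)) => //.
by rewrite ffunE /= nth_index // mem_enum.
Qed.

(** Both sides count pairs [(i, T)] with [g i] complete to [T]: for fixed [i], these [T] are the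
    [s]-tuples in the common neighborhood of [g i]. *)
Lemma double_count (I : finType) (P : {set I}) (g : I -> {set V}) E A B s :
  {in P, forall i, g i \subset A} ->
  \sum_(T in ffun_on (mem B))
     #|[set i in P |
          g i \subset common_nbrs (converse E) A (img (T : {ffun 'I_s -> V}))]|
  = \sum_(i in P) #|common_nbrs E B (g i)| ^ s.
Proof.
move=> sgA.
under eq_bigr => T _.
  rewrite -sum1dep_card big_mkcondr /=; over.
rewrite exchange_big /=; apply: eq_bigr => i iP.
rewrite -big_mkcondr /= sum1dep_card.
rewrite -[s in RHS]card_ord -card_ffun_on; apply: eq_card => T.
rewrite -[RHS]img_sub in_set -img_sub.
have [sTB|nsTB] /= := boolP (img T \subset B).
  by rewrite (subset_common_nbrs _ _ sTB) // sgA.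
apply/esym/negbTE; apply: contra nsTB => /subset_trans.
apply; exact: common_nbrs_sub.
Qed.

Definition poor E A B r m : {set {ffun 'I_r -> V}} :=
  [set f | (img f \subset A) && (#|common_nbrs E B (img f)| < m)].

(** There are at most [#|A| ^ r] poor tuples, and each survives for at most [m ^ s] choices of
    [T]. *)
Lemma poor_count E A B r s m :
  \sum_(T in ffun_on (mem B))
     #|[set f in poor E A B r m |
          img f \subset common_nbrs (converse E) A (img (T : {ffun 'I_s -> V}))]|
  <= #|A| ^ r * m ^ s.
Proof.
rewrite double_count => [|f]; last by rewrite inE => /andP[].
apply: (@leq_trans (\sum_(f in poor E A B r m) m ^ s)).
  by apply: leq_sum => f; rewrite inE => /andP[_ /ltnW]; exact: leq_expn2r.
rewrite sum_nat_const leq_mul2r; apply/orP; right.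
rewrite -[r in leqRHS]card_ord -card_ffun_on; apply: subset_leq_card.
by apply/subsetP => f; rewrite inE -img_sub => /andP[].
Qed.

Definition rich E U B r m :=
  forall S, S \subset U -> #|S| <= r -> m <= #|common_nbrs E B S|.

Lemma rich_of_tuples E A B U r m u : u \in U -> U \subset A ->
  [set f in poor E A B r m | img f \subset U] = set0 -> rich E U B r m.
Proof.
move=> uU sUA no_poor S sSU leSr.
have [f fU sSf] := sub_img uU sSU leSr.
apply: leq_trans (subset_leq_card (common_nbrs_anti E B sSf)).
have /setP/(_ f) := no_poor; rewrite !inE fU (subset_trans fU sUA) andbT /=.
by move/negbT; rewrite -leqNgt.
Qed.

(* The common neighborhood of a random s-tuple T from B has at least
   #|A| / K ^ s elements on average.  Charging #|A| for each poor r-tuple inside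
   it makes a T with positive balance free of poor r-tuples. *)
Lemma rich_subset E A B K L r s m :
  {in A, forall x, #|B| <= K * #|common_nbrs E B [set x]|} ->
  K ^ s * (L * #|B| ^ s + #|A| ^ r.+1 * m ^ s) < #|A| * #|B| ^ s ->
  exists U, [/\ U \subset A, L < #|U| & rich E U B r m].
Proof.
move=> degA lt_num.
pose nbr (T : {ffun 'I_s -> V}) := common_nbrs (converse E) A (img T).
pose bad T := [set f in poor E A B r m | img f \subset nbr T].
have [/exists_inP[T _ /andP[ltL /eqP bad0]] | none] :=
  boolP [exists T in ffun_on (mem B), (L < #|nbr T|) && (bad T == set0)].
  have [u uU] : exists u, u \in nbr T by apply/card_gt0P; exact: leq_trans ltL.
  exists (nbr T); split=> //; first exact: common_nbrs_sub.
  by apply: rich_of_tuples uU _ bad0; exact: common_nbrs_sub.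
move: lt_num; rewrite ltnNge => /negP[].
have sum_nbr : \sum_(T in ffun_on (mem B)) #|nbr T|
             = \sum_(x in A) #|common_nbrs E B [set x]| ^ s.
  rewrite -(@double_count V A set1 E A B) => [|x]; last by rewrite sub1set.
  apply: eq_bigr => T _; apply: eq_card => x; rewrite inE sub1set.
  by case: (boolP (x \in nbr T)) => [/common_nbrsP[-> _]|]; rewrite ?andbF.
apply: (@leq_trans (K ^ s * \sum_(x in A) #|common_nbrs E B [set x]| ^ s)).
  rewrite big_distrr /= -sum_nat_const; apply: leq_sum => x xA.
  by rewrite -expnMn leq_expn2r // degA.
rewrite leq_mul2l; apply/orP; right; rewrite -sum_nbr.
(* Each [T] fails: its neighborhood has at most [L] elements, or a single bad tuple, charged [#|A|],
   already pays for all of it. *)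
apply: (@leq_trans (\sum_(T in ffun_on (mem B)) (L + #|A| * #|bad T|))).
  apply: leq_sum => T TB; have := none; rewrite negb_exists_in.
  move/forall_inP/(_ T TB); rewrite negb_and -leqNgt => /orP[leL|].
    exact: leq_trans leL (leq_addr _ _).
  rewrite -card_gt0 => bad_gt0; apply: leq_trans (leq_addl _ _).
  apply: leq_trans (leq_pmulr _ bad_gt0).
  exact: subset_leq_card (common_nbrs_sub _ _ _).
rewrite big_split /= sum_nat_const card_ffun_on card_ord mulnC leq_add2l.
by rewrite -big_distrr /= expnS -mulnA leq_mul2l poor_count orbT.
Qed.

(* W is the common neighborhood of a q-tuple T from U, so a t-set S in U has as
   common neighbors in W those of S and T together in B. *)
Lemma birich_pair E B U q t m :
  #|B| ^ t * m ^ q < #|U| ^ q -> rich E U B (q + t) m -> 0 < m ->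
  exists W, rich E U W t m /\ rich (converse E) W U t m.
Proof.
move=> lt_num richU m_gt0.
pose nbr (T : {ffun 'I_q -> V}) := common_nbrs E B (img T).
pose bad T := [set f in poor (converse E) B U t m | img f \subset nbr T].
have [/exists_inP[T TU /eqP bad0] | none] :=
  boolP [exists T in ffun_on (mem U), bad T == set0].
  rewrite -img_sub in TU; exists (nbr T); split=> [S sSU leSt|].
    have := richU (img T :|: S); rewrite subUset TU sSU => /(_ isT).
    rewrite (leq_trans (leq_card_setU _ _)) ?leq_add ?card_img // => /(_ isT).
    move/leq_trans; apply; apply: subset_leq_card; apply/subsetP=> y.
    case/common_nbrsP=> yB all_y; apply/common_nbrsP; split=> [|x xS].
      by apply/common_nbrsP; split=> // x xT; apply: all_y; rewrite inE xT.
    by apply: all_y; rewrite inE xS orbT.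
  have [w wW] : exists w, w \in nbr T.
    apply/card_gt0P; apply: leq_trans m_gt0 (richU _ TU _).
    exact: leq_trans (card_img T) (leq_addr _ _).
  by apply: rich_of_tuples wW _ bad0; exact: common_nbrs_sub.
(* If each of the [#|U| ^ q] tuples [T] had a poor tuple, [poor_count] would be violated. *)
move: lt_num; rewrite ltnNge => /negP[].
apply: leq_trans (poor_count (converse E) B U t q m).
rewrite -[q in leqLHS]card_ord -card_ffun_on -sum1_card.
apply: leq_sum => T TU; rewrite card_gt0.
by have := none; rewrite negb_exists_in => /forall_inP/(_ T TU).
Qed.

End DependentRandomChoice.

(** * Embedding a degenerate bipartite graph *)

(** Vertices are placed in the order [pos]: the at most [t] placed neighbors of the next vertex lie
    on the other side, so their images have [#|H|] common neighbors, of which fewer than [#|H|] are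
    taken. *)
Lemma greedy_embedding (H : sgraph) (V : finType) (E : rel V) (U W : {set V}) t
    (P : {set H}) :
    degenerate t H -> (forall u v : H, adj u v -> (u \in P) != (v \in P)) ->
    0 < #|H| -> rich E U W t #|H| -> rich (converse E) W U t #|H| ->
  exists phi : H -> V, [/\ injective phi, {in P, forall u, phi u \in U} &
    forall u v, u \in P -> v \notin P -> adj u v -> E (phi u) (phi v)].
Proof.
move=> [pos [g posK gK] deg_pos] bipP H_gt0 richU richW.
(* [y0] is a dummy value: the induction starts from a constant map with no vertex placed. *)
have [y0 _] : exists y0, y0 \in common_nbrs E W set0.
  by apply/card_gt0P; rewrite (leq_trans H_gt0) // richU ?sub0set ?cards0.
suff partial k : k <= #|H| -> exists phi : H -> V,
    [/\ forall u v, pos u < k -> pos v < k -> phi u = phi v -> u = v,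
        forall u, pos u < k -> phi u \in (if u \in P then U else W) &
        forall u v, pos u < k -> pos v < k -> u \in P -> v \notin P ->
          adj u v -> E (phi u) (phi v)].
  have [phi [phi_inj phi_side phiE]] := partial _ (leqnn _).
  exists phi; split=> [u v|u uP|u v]; first exact: phi_inj.
    by have := phi_side u (ltn_ord _); rewrite uP.
  exact: phiE.
elim: k => [|k IHk] ltkH; first by exists (fun=> y0); split.
have [phi [phi_inj phi_side phiE]] := IHk (ltnW ltkH).
pose v0 := g (Ordinal ltkH); have pos_v0 : pos v0 = k :> nat by rewrite gK.
have pos_lt v : pos v < k.+1 -> v != v0 -> pos v < k.
  rewrite ltnS leq_eqVlt => /orP[/eqP pos_v|//] /eqP[].
  by apply: (can_inj posK); apply: val_inj; rewrite /= pos_v0.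
pose N0 := [set u : H | adj u v0 && (pos u < pos v0)].
have N0P u : u \in N0 -> adj u v0 /\ pos u < k.
  by rewrite inE pos_v0 => /andP.
pose C := if v0 \in P then common_nbrs (converse E) U (phi @: N0)
          else common_nbrs E W (phi @: N0).
have leC : #|H| <= #|C|.
  have leN0 : #|phi @: N0| <= t by apply: leq_trans (leq_imset_card _ _) (deg_pos _).
  have sub : phi @: N0 \subset (if v0 \in P then W else U).
    apply/subsetP => _ /imsetP[u /N0P[adj_u /phi_side phi_u] ->].
    by have := bipP _ _ adj_u; move: phi_u; case: (u \in P); case: (v0 \in P).
  by rewrite /C; case: (v0 \in P) sub => sub; [apply: richW | apply: richU].
pose used := phi @: [set u | pos u < k].
have lt_used : #|used| < #|H|.
  apply: leq_ltn_trans (leq_imset_card _ _) _.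
  rewrite -[ltnRHS]cardsT; apply: proper_card; rewrite properT.
  by apply/eqP => /setP/(_ v0); rewrite !inE pos_v0 ltnn.
have [y yC y_new] : exists2 y, y \in C & y \notin used.
  apply/subsetPn; apply: contraL lt_used => /subset_leq_card.
  by rewrite -leqNgt; exact: leq_trans.
have newP u : pos u < k -> phi u != y.
  by move=> lt_u; apply: contraNneq y_new => <-; rewrite imset_f // inE.
exists (fun v => if v == v0 then y else phi v); split=> [u v|u|u v] ltu.
- move=> ltv; case: (eqVneq u v0) => [-> | uN]; case: (eqVneq v v0) => [-> | vN] //.
  + by move/esym/eqP; rewrite (negPf (newP _ (pos_lt _ ltv vN))).
  + by move/eqP; rewrite (negPf (newP _ (pos_lt _ ltu uN))).
  + exact: phi_inj (pos_lt _ ltu uN) (pos_lt _ ltv vN).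
- case: (eqVneq u v0) => [-> | uN]; last exact: phi_side (pos_lt _ ltu uN).
  by move: yC; rewrite /C; case: (v0 \in P); exact: (subsetP (common_nbrs_sub _ _ _)).
move=> ltv uP vP adj_uv.
case: (eqVneq u v0) => [def_u | uN]; case: (eqVneq v v0) => [def_v | vN].
- by rewrite def_u -def_v (negPf vP) in uP.
- move: yC; rewrite /C -def_u uP => /common_nbrsP[_]; apply.
  by rewrite imset_f // inE pos_v0 pos_lt // -def_u adj_sym adj_uv.
- move: yC; rewrite /C -def_v (negPf vP) => /common_nbrsP[_]; apply.
  by rewrite imset_f // inE pos_v0 pos_lt // -def_v adj_uv.
- by apply: phiE => //; exact: pos_lt.
Qed.

Lemma dense_embedding (H : sgraph) (V : finType) (E : rel V) (A : {set V}) t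
    (P : {set H}) :
    degenerate t H -> (forall u v : H, adj u v -> (u \in P) != (v \in P)) ->
    0 < t -> 1 < #|H| -> #|V| = #|H| ^ (256 * t) ->
    #|H| ^ (128 * t - 1) <= #|A| ->
    {in A, forall x, #|V| <= #|H| ^ 6 * #|common_nbrs E setT [set x]|} ->
  exists phi : H -> V, [/\ injective phi, {in P, forall u, phi u \in A} &
    forall u v, u \in P -> v \notin P -> adj u v -> E (phi u) (phi v)].
Proof.
move=> deg bipP t_gt0 H_gt1 cardV leA degA.
have H_gt0 := ltnW H_gt1.
set n := #|H| in H_gt1 H_gt0 cardV leA degA.
have leAV : #|A| <= n ^ (256 * t) by rewrite -cardV max_card.
have A_gt0 : 0 < #|A| by apply: leq_trans leA; rewrite expn_gt0 H_gt0.
(* With [s = 10 * t], the exponent [256 * t * s] exceeds [70 * t + 256 * t * (5 * t)] from the poor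
   tuples, while [60 * t + 65 * t] stays below [128 * t - 1]. *)
have [||U [sUA ltU richU]] :=
  @rich_subset V E A setT (n ^ 6) (n ^ (65 * t)) (4 * t + t) (10 * t) n.
- by rewrite cardsT.
- rewrite cardsT cardV mulnDr !mulnA -!expnM -!expnD.
  set b := n ^ (256 * t * (10 * t)).
  have b_gt0 : 0 < b by rewrite expn_gt0 H_gt0.
  have double e e' : e < e' -> n ^ e * 2 <= n ^ e'.
    move=> lt_e; apply: (@leq_trans (n ^ e.+1)); last by rewrite leq_exp2l.
    by rewrite expnSr leq_mul2l H_gt1 orbT.
  have main : n ^ (6 * (10 * t) + 65 * t) * b * 2 <= #|A| * b.
    rewrite mulnAC leq_mul2r; apply/orP; right; apply: leq_trans leA.
    by apply: double; lia.
  have err : n ^ (6 * (10 * t)) * #|A| ^ (4 * t + t).+1 * n ^ (10 * t) * 2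
             < #|A| * b.
    rewrite expnS mulnCA -!mulnA ltn_pmul2l //.
    apply: (@leq_ltn_trans (n ^ (6 * (10 * t)) * ((n ^ (256 * t)) ^ (4 * t + t)
       * (n ^ (10 * t) * 2)))).
      by rewrite leq_mul2l leq_mul2r leq_expn2r ?orbT.
    rewrite mulnA -expnM -expnD mulnA -expnD.
    apply: (@leq_ltn_trans (n ^ (6 * (10 * t) + 256 * t * (4 * t + t) + 10 * t).+1)).
      exact: double.
    by rewrite ltn_exp2l //; nia.
  by rewrite expnD -/b; lia.
(* The exponents satisfy [256 * t * t + 4 * t <= 65 * t * (4 * t)], with equality at [t = 1];
   strictness comes from [n ^ (65 * t) < #|U|]. *)
have [||W [richUW richWU]] := @birich_pair V E setT U (4 * t) t n _ richU _ => //.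
  rewrite cardsT cardV.
  apply: (@leq_ltn_trans ((n ^ (65 * t)) ^ (4 * t))).
    by rewrite -!expnM -expnD leq_exp2l //; nia.
  by rewrite ltn_exp2r //; lia.
have [phi [phi_inj phiU phiE]] := greedy_embedding deg bipP H_gt0 richUW richWU.
by exists phi; split=> // u /phiU; exact: (subsetP sUA).
Qed.

(** * Rainbow copies from random maps *)

(** Union bound over [#|H| ^ 4] quadruples: once the values of [f] off [z] are fixed, at most [D] of
    the [#|A|] values of [f z] clash. *)
Lemma rainbow_embedding (H : sgraph) N (chi : edge_coloring N) (A : {set 'I_N}) D :
    {in A, forall v c, #|[set u in A | (u == v) || (chi [set v; u] == c)]| <= D} ->
    #|H| ^ 4 * D < #|A| ->
  exists2 phi : H -> 'I_N, injective phi & rainbow chi phi.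
Proof.
move=> few ltA; have A_gt0 : 0 < #|A| by exact: leq_ltn_trans ltA.
(* The disjunct [u == f w] makes the absence of clashes yield injectivity too. *)
pose clash (f : {ffun H -> 'I_N}) (x y w : H) u :=
  (u == f w) || (chi [set f w; u] == chi [set f x; f y]).
pose F : {set {ffun H -> 'I_N}} := [set f in ffun_on (mem A)].
have cardF : #|F| = #|A| ^ #|H| by rewrite cardsE card_ffun_on.
have FP f v : f \in F -> f v \in A by rewrite inE => /ffun_onP.
pose valid (q : H * H * H * H) :=
  let: (x, y, w, z) := q in [&& z != x, z != y & z != w].
pose bad (q : H * H * H * H) :=
  let: (x, y, w, z) := q in [set f in F | valid q && clash f x y w (f z)].
have card_bad q : #|bad q| * #|A| <= #|A| ^ #|H| * D.
  case: q => [[[x y] w] z]; rewrite /bad /valid.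
  case: (boolP [&& _, _ & _]) => [/and3P[zx zy zw] | _]; last first.
    by rewrite (eq_card0 (A := [set f in F | _])) // => f; rewrite inE andbF.
  pose pairs := [set p in setX F A | clash p.1 x y w p.2].
  apply: (@leq_trans #|pairs|); last first.
    rewrite -cardF -sum_nat_const -sum1dep_card.
    rewrite (eq_bigl (fun p => (p.1 \in F) && ((p.2 \in A) && clash p.1 x y w p.2)));
      last by case=> f u; rewrite in_setX /= andbA.
    rewrite -(pair_big_dep (mem F) (fun f u => (u \in A) && clash f x y w u)
                (fun _ _ => 1)) /=.
    apply: leq_sum => f fF; rewrite sum1dep_card.
    exact: few (FP _ _ fF) _.
  rewrite -cardsX.
  (* Trading the value at z, which only affects the last argument of [clash],
     makes the bad maps times A embed into the clashing pairs. *)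
  pose swap (p : {ffun H -> 'I_N} * 'I_N) :=
    ([ffun v => if v == z then p.2 else p.1 v], p.1 z).
  rewrite -(@card_in_imset _ _ swap) => [|[f a] [f' a'] _ _ [/ffunP eq_f eq_z]].
    apply: subset_leq_card; apply/subsetP => _ /imsetP[[f a] /setXP[fb aA] ->].
    move: fb; rewrite !inE /= => /andP[/ffun_onP fA cl]; apply/andP; split.
      rewrite fA andbT; apply/ffun_onP => v; rewrite ffunE.
      by case: ifP.
    by rewrite /clash !ffunE !(eq_sym _ z) (negPf zx) (negPf zy) (negPf zw).
  congr pair; last by have := eq_f z; rewrite !ffunE eqxx.
  apply/ffunP => v; have := eq_f v; rewrite !ffunE.
  by case: eqP => [->|].
have [f fF f_good] : exists2 f, f \in F & forall q, f \notin bad q.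
  have [/exists_inP[f fF /forallP good] | none] :=
    boolP [exists f in F, [forall q, f \notin bad q]]; first by exists f.
  have : #|A| ^ #|H| * #|A| <= #|H| ^ 4 * D * #|A| ^ #|H|.
    apply: (@leq_trans (\sum_q #|bad q| * #|A|)).
      rewrite -big_distrl leq_mul2r -cardF /=; apply/orP; right.
      apply: (@leq_trans #|\bigcup_q bad q|).
        apply: subset_leq_card; apply/subsetP => f fF.
        move: none; rewrite negb_exists_in => /forall_inP/(_ f fF).
        rewrite negb_forall => /existsP[q]; rewrite negbK => fq.
        by apply/bigcupP; exists q.
      by apply: (big_rec2 (fun (S : {set _}) k => #|S| <= k)) => [|q S k _ le_k];
        rewrite ?cards0 // (leq_trans (leq_card_setU _ _)) // leq_add2l.
    apply: (@leq_trans (\sum_(q : H * H * H * H) #|A| ^ #|H| * D)).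
      by apply: leq_sum => q _.
    by rewrite sum_nat_const !card_prod (mulnC (#|A| ^ _)) (expnD _ 2 2) -!mulnn !mulnA.
  by rewrite mulnC leq_mul2r expn_eq0 gtn_eqF //= leqNgt ltA.
have no_clash (x y w z : H) :
    z != x -> z != y -> z != w -> ~~ clash f x y w (f z).
  move=> zx zy zw; have := f_good (x, y, w, z); apply: contra => cl.
  by rewrite /bad in_set fF /valid zx zy zw.
have f_inj : injective f.
  move=> w z eq_f; apply/eqP; rewrite eq_sym; apply/negPn/negP => zw.
  by have := no_clash w w w z zw zw zw; rewrite /clash eq_f eqxx.
exists f => // e1 e2 + + eq_chi.
rewrite !inE => /existsP[x /existsP[y /andP[_ /eqP def1]]].
move=> /existsP[w /existsP[z /andP[adj_wz /eqP def2]]].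
have wz : w != z by apply: contraTneq adj_wz => ->; rewrite adj_irrefl.
move: eq_chi; rewrite /= def1 def2 !imsetU !imset_set1 => eq_chi.
(* An end of [e2] outside [e1] could play the role of [z] in a clash; hence both ends of [e2] lie in
   [e1]. *)
have in_e1 a b : a != b -> chi [set f a; f b] = chi [set f x; f y] ->
    b \in [set x; y].
  move=> ab eq_ab.
  rewrite !inE -[_ || _]negbK negb_or; apply/negP => /andP[bx b'y].
  have := no_clash x y a b bx b'y.
  by rewrite eq_sym ab /clash eq_ab eqxx orbT => /(_ isT).
have z1 := in_e1 w z wz (esym eq_chi).
have w1 : w \in [set x; y] by apply: (in_e1 z w); rewrite 1?eq_sym // setUC.
apply/eqP; rewrite eq_sym eqEcard subUset !sub1set w1 z1 !cards2 wz.
by case: (_ != _).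
Qed.

(** * Lexicographic copies and the pigeonhole step *)

Lemma lexicographic_of_stars (H : sgraph) N (chi : edge_coloring N)
    (phi : H -> 'I_N) (P : {set H}) (c : H -> nat) :
    (forall u v : H, adj u v -> (u \in P) != (v \in P)) ->
    {in P &, injective c} ->
    (forall u v : H, u \in P -> v \notin P -> adj u v ->
       chi [set phi u; phi v] = c u) ->
  lexicographic chi phi.
Proof.
move=> bipP c_inj chi_c; pose s := enum P ++ enum (~: P).
have mem_s v : v \in s by rewrite mem_cat !mem_enum inE; case: (v \in P).
have size_s : size s = #|H| by rewrite size_cat -!cardE cardsC.
have lt_s v : index v s < #|H| by rewrite -size_s index_mem.
exists (fun v => Ordinal (lt_s v)).
  apply: inj_card_bij; last by rewrite card_ord.
  by move=> u v [/index_inj]; apply.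
pose M := \max_v c v.
have leM v : c v <= M by exact: leq_bigmax.
(* Vertices outside [P] come last and have no later neighbors; they get fresh colors above [M]. *)
exists (fun v => if v \in P then c v else M.+1 + enum_rank v).
  move=> u v; case: (boolP (u \in P)) => uP; case: (boolP (v \in P)) => vP.
  - exact: c_inj.
  - by have := leM u; lia.
  - by have := leM v; lia.
  - by move/addnI/val_inj/enum_rank_inj.
move=> u v adj_uv /=; have := bipP _ _ adj_uv.
case: (boolP (u \in P)) => uP; case: (boolP (v \in P)) => vP //= _.
  by move=> _; exact: chi_c.
rewrite /s !index_cat !mem_enum (negPf uP) vP ltnNge => /negP[].
by apply: leq_trans (leq_addr _ _); rewrite ltnW // index_mem mem_enum.
Qed.

(** Either [c] takes at least [a] values on [A], and one representative of each is kept, or some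
    value is taken at least [a] times. *)
Lemma injective_or_constant (T : finType) (c : T -> nat) (A : {set T}) a :
    a * a < #|A| ->
  exists A' : {set T}, [/\ A' \subset A, a <= #|A'| &
    {in A' &, injective c} \/ exists d, {in A', forall x, c x = d}].
Proof.
move=> ltA; pose rep x := odflt x [pick y in A | c y == c x].
have repP x : x \in A -> rep x \in A /\ c (rep x) = c x.
  move=> xA; rewrite /rep; case: pickP => [y /andP[yA /eqP] // | /(_ x)].
  by rewrite xA eqxx.
have rep_eq x y : x \in A -> y \in A -> c x = c y -> rep x = rep y.
  move=> xA yA eq_c; rewrite /rep eq_c; case: pickP => // /(_ y).
  by rewrite yA eqxx.
have [leA' | ltA'] := leqP a #|rep @: A|.
  exists (rep @: A); split=> //.
    by apply/subsetP=> _ /imsetP[x /repP[repA _] ->].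
  left=> _ _ /imsetP[x xA ->] /imsetP[y yA ->].
  by rewrite (proj2 (repP x xA)) (proj2 (repP y yA)); exact: rep_eq.
have [/exists_inP[y _ le_y] | none] :=
  boolP [exists y in rep @: A, a <= #|[set x in A | rep x == y]|].
  exists [set x in A | rep x == y]; split=> //.
    by apply/subsetP=> x; rewrite inE => /andP[].
  right; exists (c y) => x; rewrite inE => /andP[/repP[_ <-] /eqP->] //.
move: ltA; rewrite ltnNge => /negP[].
rewrite -sum1_card (partition_big rep (mem (rep @: A))) => [|x xA]; last exact: imset_f.
apply: (@leq_trans (\sum_(y in rep @: A) a)).
  apply: leq_sum => y yA; rewrite sum1dep_card.
  move: none; rewrite negb_exists_in => /forall_inP/(_ y yA).
  by rewrite -ltnNge => /ltnW.
by rewrite sum_nat_const leq_mul2r ltnW // orbT.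
Qed.

(** * The bound for graphs with at least two vertices *)

Lemma canonical_ramsey_bound (H : sgraph) t :
  0 < t -> 1 < #|H| -> bipartite H -> degenerate t H ->
  canonical_ramsey H (#|H| ^ (256 * t)).
Proof.
move=> t_gt0 H_gt1 [P bipP] deg chi.
set n := #|H| in H_gt1 chi *; set N := n ^ (256 * t) in chi *.
have H_gt0 := ltnW H_gt1.
pose D := n ^ (256 * t - 6).
have DN : n ^ 6 * D = N by rewrite -expnD; congr (_ ^ _); lia.
have D_gt0 : 0 < D by rewrite expn_gt0 H_gt0.
have sq_ge4 : 4 <= n ^ 2 by rewrite (@leq_exp2r 2 n 2).
(* Counting [v] itself fits [rainbow_embedding]; the strict inequality makes up for this one vertex
   in [degE]. *)
pose heavy v c := D < #|[set u : 'I_N | (u == v) || (chi [set v; u] == c)]|.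
pose light := [set v | [forall u : 'I_N, ~~ heavy v (chi [set v; u])]].
have lightP v c : v \in light -> ~~ heavy v c.
  rewrite inE => /forallP light_v.
  have [/existsP[u /eqP <-] // | none] := boolP [exists u, chi [set v; u] == c].
  rewrite -leqNgt; apply: leq_trans D_gt0; rewrite -(cards1 v).
  apply: subset_leq_card; apply/subsetP=> u; rewrite !inE => /orP[//|/eqP chi_u].
  by case/existsP: none; exists u; rewrite chi_u.
(* Since [n >= 2], [n ^ 4 * D = N / n ^ 2] is at most [N / 4], below the size of [light]. *)
have [le_light | lt_light] := leqP N (#|light| * 2).
  have [||phi phi_inj rb] := @rainbow_embedding H N chi light D; first 2 last.
  - by exists phi => //; apply: Or32.
  - move=> v /lightP not_heavy c; move: (not_heavy c); rewrite -leqNgt.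
    apply: leq_trans; apply: subset_leq_card; apply/subsetP=> u.
    by rewrite !inE => /andP[].
  - have eqN : n ^ 2 * (n ^ 4 * D) = N by rewrite mulnA -expnD.
    have x_gt0 : 0 < n ^ 4 * D by rewrite muln_gt0 expn_gt0 H_gt0.
    rewrite -(ltn_pmul2r (isT : 0 < 2)); apply: leq_trans le_light.
    have := leq_mul sq_ge4 (leqnn (n ^ 4 * D)); rewrite eqN; apply: leq_trans.
    by move: (n ^ 4 * D) x_gt0 => x; clear; lia.
(* The default 0 occurs only at light vertices. *)
pose c v := if [pick u : 'I_N | heavy v (chi [set v; u])] is Some u
            then chi [set v; u] else 0.
have heavyP v : v \in ~: light -> heavy v (c v).
  rewrite !inE negb_forall => /existsP[u]; rewrite negbK => heavy_u.
  by rewrite /c; case: pickP => [|/(_ u)] //; rewrite heavy_u.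
pose E : rel 'I_N := fun v u => chi [set v; u] == c v.
have degE v : v \in ~: light -> #|'I_N| <= n ^ 6 * #|common_nbrs E setT [set v]|.
  move/heavyP=> heavy_v; rewrite [leqLHS]card_ord -[leqLHS]DN leq_mul2l; apply/orP; right.
  rewrite -ltnS; apply: leq_trans heavy_v _.
  rewrite -add1n -(cards1 v); apply: leq_trans (leq_card_setU _ _).
  apply: subset_leq_card; apply/subsetP=> u; rewrite !inE => /orP[-> // | chi_u].
  by apply/orP; right; apply/forall_inP => x; rewrite inE => /eqP ->.
(* The square of [n ^ (128 * t - 1)] is [N / n ^ 2], at most [N / 4], and more than half of the
   vertices are not light. *)
have [|A [sA leA cA]] := @injective_or_constant _ c (~: light) (n ^ (128 * t - 1)).
  set X := _ * _; have card_light := cardsC light.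
  rewrite [RHS]card_ord in card_light.
  have eqN : n ^ 2 * X = N by rewrite /X -!expnD; congr (_ ^ _); lia.
  have leX := leq_mul sq_ge4 (leqnn X); rewrite eqN in leX.
  have arith l l' x M : l + l' = M -> l * 2 < M -> 4 * x <= M -> x < l'.
    by clear; lia.
  exact: arith card_light lt_light leX.
have [||phi [phi_inj phiA phiE]] :=
  @dense_embedding H _ E A t P deg bipP t_gt0 H_gt1 _ leA.
- by rewrite card_ord.
- by move=> v /(subsetP sA); exact: degE.
have chi_c u v : u \in P -> v \notin P -> adj u v ->
    chi [set phi u; phi v] = c (phi u).
  by move=> uP vP adj_uv; apply/eqP; exact: phiE.
exists phi => //; case: cA => [c_inj | [d c_d]].
  apply: Or33; apply: (lexicographic_of_stars (c := c \o phi) bipP) => // u v uP vP.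
  by move/(c_inj _ _ (phiA _ uP) (phiA _ vP))/phi_inj.
apply: Or31; exists d => e; rewrite inE => /existsP[u /existsP[v /andP[adj_uv /eqP->]]].
rewrite imsetU !imset_set1; have := bipP _ _ adj_uv.
case: (boolP (u \in P)) => uP; case: (boolP (v \in P)) => vP //= _.
  by rewrite chi_c // c_d // phiA.
by rewrite setUC chi_c 1?adj_sym // c_d // phiA.
Qed.

(** * The one-vertex case and the existence of the minimum *)

Lemma canonical_ramsey1 (H : sgraph) : #|H| = 1 -> canonical_ramsey H 1.
Proof.
move=> H1 chi.
have H_eq (u v : H) : u = v.
  by apply: (fintype_le1P _); rewrite H1.
exists (fun=> ord0) => [u v _|]; first exact: H_eq.
apply: Or31; exists 0 => e; rewrite inE => /existsP[u /existsP[v /andP[+ _]]].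
by rewrite (H_eq u v) adj_irrefl.
Qed.

(** Descent from [M]; excluded middle decides whether a smaller value works, as [canonical_ramsey]
    is a proposition over all colorings. *)
Lemma is_ER_exists (H : sgraph) M :
  canonical_ramsey H M -> exists2 N, is_ER H N & N <= M.
Proof.
have [k] := ubnP M; elim: k M => // k IHk M leMk ramM.
have [[M' [ramM' ltM']] | none] := classic (exists M', canonical_ramsey H M' /\ M' < M).
  have [|N erN leN] := IHk M' _ ramM'; first exact: leq_trans ltM' _.
  by exists N => //; exact: leq_trans leN (ltnW ltM').
exists M => //; split=> // M' ramM'; rewrite leqNgt; apply/negP => ltM'.
by apply: none; exists M'.
Qed.

Theorem theorem2p1 :
  exists C : nat, forall (n t : nat) (H : sgraph),
    0 < n -> 0 < t -> #|H| = n -> bipartite H -> degenerate t H ->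
    exists2 N : nat, is_ER H N & N <= n ^ (C * t).
Proof.
exists 256 => n t H n_gt0 t_gt0 cardH bipH degH; apply: is_ER_exists.
rewrite -cardH; case: (ltngtP #|H| 1) => [|H_gt1|H1].
- by rewrite cardH ltnNge n_gt0.
- exact: canonical_ramsey_bound.
- by rewrite H1 exp1n; exact: canonical_ramsey1.
Qed.
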